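(* Let $u=(u_1,v_2w_2)$ and $v=(u_1w_1,v_2)$ be vectors in $\mathbb C^2$ with $|u_1|,|v_2|>0$ and $|w_1|,|w_2|<1$. For $x=(x_1,x_2)\in\mathbb C^2$ put $|x|_{u,v}=\max\bigl(\tfrac{|x_1|}{\max(|u_1|,|v_1|)},\tfrac{|x_2|}{\max(|u_2|,|v_2|)}\bigr)$, where $u=(u_1,u_2)$, $v=(v_1,v_2)$. \begin{enumerate} \item If $|gu+hv|_{u,v}>1$ for all nonzero $g,h\in\mathbb Z[i]$ with $|g|\,|h|\le\sqrt2$, then $|z|_{u,v}>1$ for all nonzero $z\in(\mathbb Z[i]u+\mathbb Z[i]v)\setminus(\mathbb U_4u\cup\mathbb U_4v)$. \item If $|gu+hv|_{u,v}>1$ for the four pairs $(g,h)=(\tfrac1{1+i},\tfrac{\alpha}{1+i})$, $\alpha\in\mathbb U_4$, then $|z|_{u,v}>1$ for all nonzero $z\in\langle u,v\rangle_J\setminus(\mathbb U_4u\cup\mathbb U_4v)$. \end{enumerate}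
   Context: $\mathbb U_4=\{1,-1,i,-i\}$. $J=\tfrac{1}{1+i}\mathbb Z[i]\setminus\mathbb Z[i]$ and $\langle u,v\rangle_J=\{gu+hv:(g,h)\in\mathbb Z[i]^2\cup J^2\}$. *)

(* Defs.v *)
From Stdlib Require Import Reals ZArith.
From Coquelicot Require Import Coquelicot.

Open Scope R_scope.
Open Scope C_scope.

(** [C ^ 2] is the product [C * C] with its library structure of [C]-module:
    [plus], [scal] and [zero] are componentwise. *)
Definition C2 : Type := (C * C)%type.

Definition lincomb (g h : C) (u v : C2) : C2 := plus (scal g u) (scal h v).

(** Total, since [Rdiv] is; it is the weighted max-norm when both denominators
    are positive. *)
Definition uvnorm (u v x : C2) : R :=
  Rmax (Cmod (fst x) / Rmax (Cmod (fst u)) (Cmod (fst v)))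
       (Cmod (snd x) / Rmax (Cmod (snd u)) (Cmod (snd v))).

Definition gaussInt (z : C) : Prop := exists a b : Z, z = (IZR a, IZR b).

Definition U4 (z : C) : Prop := z = 1 \/ z = - 1 \/ z = Ci \/ z = - Ci.

Definition J (z : C) : Prop :=
  (exists g : C, gaussInt g /\ z = / (1 + Ci) * g) /\ ~ gaussInt z.

Definition gaussSpan (u v z : C2) : Prop :=
  exists g h : C, gaussInt g /\ gaussInt h /\ z = lincomb g h u v.

(** [<u, v>_J]; the pair [(g, h)] is in [Z[i]^2] or in [J^2], never mixed. *)
Definition jSpan (u v z : C2) : Prop :=
  exists g h : C,
    ((gaussInt g /\ gaussInt h) \/ (J g /\ J h)) /\ z = lincomb g h u v.

Definition U4orbit (u z : C2) : Prop :=
  exists e : C, U4 e /\ z = scal e u.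

(* Main.v *)
(** Dividing out [u1] and [v2], the vector [g u + h v] has norm at most [1] iff
    [|g + h w1| <= 1] and [|h + g w2| <= 1]: with [x = - w1] and [t = - conj w2], the
    points [x] and [t] of the open unit disc lie close to [g / h] and [conj (h / g)],
    which have the same argument.  Both are within [arcsin (1 / min (|g|, |h|))] of
    this argument.  By the dihedral symmetry and the exchange of [u] and [v] one may
    assume that the argument is in [[0, pi/4]] and [|h| <= |g|].  When [|h|^2 >= 5],
    [x] and [t] are then both in the unit disc around [1], or both in the one around
    [i], or [x] is in the unit disc around [1 + i] and [t] in the disc with diameter
    [[1, i]]; these are the short pairs [(1, 1)], [(i, 1)] and [(1 + i, 1)].  When [|h|^2 <= 4], the bound [|g| < |h| + 1]
    leaves finitely many cases.  For [(g, h)] in [J^2], scaled by [1 + i], the same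
    angular estimate puts both [x] and [t] in the half-plane [Re >= 0], hence at
    distance at most [sqrt 2] from [1], again up to finitely many cases. *)

Require Import Defs.
From Stdlib Require Import Reals ZArith Lra Lia Psatz.
From Coquelicot Require Import Coquelicot.

Open Scope R_scope.
Open Scope C_scope.

Local Open Scope R_scope.

(** After the substitution [x = - w1], [t = - conj w2], [(m, n) = g * conj h],
    [k = |g|^2], [l = |h|^2], the inequalities say [|g + h w1|^2 <= r] and
    [|h + g w2|^2 <= r]. *)
Definition near (r k l m n x1 x2 t1 t2 : R) : Prop :=
  k - r + l * (x1 ^ 2 + x2 ^ 2) <= 2 * (m * x1 + n * x2) /\
  l - r + k * (t1 ^ 2 + t2 ^ 2) <= 2 * (m * t1 + n * t2).

(** * Size bound and plane geometry of cones and discs *)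

Lemma unit_pythagoras (e1 e2 x1 x2 : R) :
  e1 ^ 2 + e2 ^ 2 = 1 ->
  x1 ^ 2 + x2 ^ 2 = (e1 * x1 + e2 * x2) ^ 2 + (e1 * x2 - e2 * x1) ^ 2.
Proof.
intro He; transitivity ((e1 ^ 2 + e2 ^ 2) * (x1 ^ 2 + x2 ^ 2)); [rewrite He|]; ring.
Qed.

(** This is the triangle inequality |g| < sqrt r + |h| in a squared form free of roots. *)
Lemma near_size_bound (r k l m n x1 x2 t1 t2 : R) :
  0 < r -> r <= k -> 0 < l -> l <= k -> m * m + n * n = k * l ->
  x1 ^ 2 + x2 ^ 2 < 1 -> near r k l m n x1 x2 t1 t2 ->
  (k + l - r) ^ 2 < 4 * (k * l).
Proof.
intros Hr Hrk Hl Hlk HA HX [Hx _].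
remember (x1 ^ 2 + x2 ^ 2) as X eqn:EX.
assert (HX0 : 0 <= X) by (subst X; nra).
assert (HCS : (m * x1 + n * x2) ^ 2 <= k * l * X).
{ rewrite <- HA, EX. assert (0 <= (m * x2 - n * x1) ^ 2) by apply pow2_ge_0. nra. }
assert (Hsq : (k - r + l * X) ^ 2 <= 4 * (k * l * X)).
{ assert (0 <= k - r + l * X) by nra.
  apply Rle_trans with ((2 * (m * x1 + n * x2)) ^ 2); [apply pow_incr; lra | lra]. }
(* Raising [X] to 1 increases [4 k l X - (k - r + l X)^2] by
   [2 l (k + r - l) (1 - X) + (l (1 - X))^2]. *)
assert (0 < l * (k + r - l) * (1 - X)) by (repeat apply Rmult_lt_0_compat; lra).
assert (0 <= (l * (1 - X)) ^ 2) by apply pow2_ge_0.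
nra.
Qed.

(** The angle between [x] and the unit vector [e] has tangent at most [1/2]. *)
Lemma cone_half (e1 e2 x1 x2 : R) :
  e1 ^ 2 + e2 ^ 2 = 1 -> 0 <= e1 * x1 + e2 * x2 ->
  4 / 5 * (x1 ^ 2 + x2 ^ 2) <= (e1 * x1 + e2 * x2) ^ 2 ->
  2 * (e1 * x2 - e2 * x1) <= e1 * x1 + e2 * x2 /\
  - (e1 * x1 + e2 * x2) <= 2 * (e1 * x2 - e2 * x1).
Proof.
intros He Hd Hc.
assert (E := unit_pythagoras e1 e2 x1 x2 He).
rewrite E in Hc.
assert (Habs : Rabs (2 * (e1 * x2 - e2 * x1)) <= Rabs (e1 * x1 + e2 * x2)).
{ apply Rsqr_le_abs_0; unfold Rsqr; lra. }
rewrite (Rabs_pos_eq _ Hd) in Habs.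
apply Rabs_le_between in Habs; destruct Habs; split; lra.
Qed.

(** A point outside the unit disc around [1] has argument above 60 degrees,
    hence [e] has argument above [atan (3/5)]. *)
Lemma off_axis_slope (e1 e2 x1 x2 : R) :
  e1 ^ 2 + e2 ^ 2 = 1 -> 0 <= e2 -> e2 <= e1 -> x1 ^ 2 + x2 ^ 2 < 1 ->
  0 <= e1 * x1 + e2 * x2 ->
  4 / 5 * (x1 ^ 2 + x2 ^ 2) <= (e1 * x1 + e2 * x2) ^ 2 ->
  2 * x1 < x1 ^ 2 + x2 ^ 2 -> 3 * e1 <= 5 * e2.
Proof.
intros He He2 He12 HX Hd Hc H1.
destruct (cone_half e1 e2 x1 x2 He Hd Hc) as [Ha Hb].
destruct (Rle_or_lt (3 * e1) (5 * e2)) as [|Hs]; [assumption|exfalso].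
assert (He1 : 0 < e1) by nra.
assert (Hx1 : 0 <= x1).
{ assert (x1 = e1 * (e1 * x1 + e2 * x2) - e2 * (e1 * x2 - e2 * x1)).
  { transitivity ((e1 ^ 2 + e2 ^ 2) * x1); [rewrite He; ring | ring]. }
  nra. }
(* The slope 11/7 is tan (atan (3/5) + atan (1/2)), which is below sqrt 3 = tan 60°. *)
assert (Hu : 7 * x2 <= 11 * x1).
{ assert (x2 * (2 * e1 - e2) <= x1 * (e1 + 2 * e2)) by lra. nra. }
assert (Hl : - (11 * x1) <= 7 * x2).
{ assert (x1 * (2 * e2 - e1) <= x2 * (2 * e1 + e2)) by lra. nra. }
nra.
Qed.

(** The argument of [e] lies between atan (3/5) > atan (1/2) and 45 degrees, and [t] deviates from
    it by at most atan (1/2). *)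
Lemma nonneg_coords_of_cone (e1 e2 t1 t2 : R) :
  e1 ^ 2 + e2 ^ 2 = 1 -> 0 <= e2 -> e2 <= e1 -> 3 * e1 <= 5 * e2 ->
  0 <= e1 * t1 + e2 * t2 ->
  4 / 5 * (t1 ^ 2 + t2 ^ 2) <= (e1 * t1 + e2 * t2) ^ 2 ->
  0 <= t1 /\ 0 <= t2.
Proof.
intros He He2 He12 Hs Hd Hc.
destruct (cone_half e1 e2 t1 t2 He Hd Hc) as [Ha Hb].
assert (E1 : t1 = e1 * (e1 * t1 + e2 * t2) - e2 * (e1 * t2 - e2 * t1)).
{ transitivity ((e1 ^ 2 + e2 ^ 2) * t1); [rewrite He; ring | ring]. }
assert (E2 : t2 = e2 * (e1 * t1 + e2 * t2) + e1 * (e1 * t2 - e2 * t1)).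
{ transitivity ((e1 ^ 2 + e2 ^ 2) * t2); [rewrite He; ring | ring]. }
remember (e1 * t1 + e2 * t2) as p eqn:Ep.
remember (e1 * t2 - e2 * t1) as q eqn:Eq.
assert (0 <= e2 * (p - 2 * q)) by (apply Rmult_le_pos; lra).
assert (0 <= e1 * (p + 2 * q)) by (apply Rmult_le_pos; lra).
assert (0 <= (e1 - e2) * p) by (apply Rmult_le_pos; lra).
assert (0 <= (5 * e2 - 3 * e1) * p) by (apply Rmult_le_pos; lra).
assert (0 <= e2 * p) by (apply Rmult_le_pos; lra).
split; lra.
Qed.

(** The last hypothesis puts [x] within 1/sqrt 5 of [e]. On this arc [e] is within 0.51 of 1 + i,
    and 0.51 + 1/sqrt 5 < 1, so [x] is in the unit disc around 1 + i. *)
Lemma diagonal_of_slope (e1 e2 x1 x2 : R) :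
  e1 ^ 2 + e2 ^ 2 = 1 -> 0 <= e2 -> e2 <= e1 -> 3 * e1 <= 5 * e2 ->
  x1 ^ 2 + x2 ^ 2 + 4 / 5 <= 2 * (e1 * x1 + e2 * x2) ->
  1 + (x1 ^ 2 + x2 ^ 2) <= 2 * (x1 + x2).
Proof.
intros He He2 He12 Hs Hx.
apply Rnot_lt_le; intro HD.
assert (Hdisc : (x1 - e1) ^ 2 + (x2 - e2) ^ 2 <= 1 / 5) by nra.
assert (Hsq : (3 * e1) ^ 2 <= (5 * e2) ^ 2) by (apply pow_incr; lra).
(* The constants 0.514, 0.858 and 0.448 round 3/sqrt 34, 5/sqrt 34 and 1/sqrt 5; the bound 3/10 on
   [X] rounds (1 - 1/sqrt 5)^2 down. *)
assert (L2 : 514 / 1000 <= e2) by nra.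
assert (U1 : e1 <= 858 / 1000).
{ assert ((514 / 1000) ^ 2 <= e2 ^ 2) by (apply pow_incr; lra). nra. }
assert (Lx2 : e2 - 448 / 1000 <= x2).
{ assert (0 <= (x1 - e1) ^ 2) by apply pow2_ge_0. nra. }
assert (HX00 : 0 <= x1 ^ 2 + x2 ^ 2) by nra.
remember (x1 ^ 2 + x2 ^ 2) as X eqn:EX.
assert (HX0 : 3 / 10 <= X).
{ assert ((e1 * x1 + e2 * x2) ^ 2 <= X).
  { rewrite EX. assert (0 <= (e1 * x2 - e2 * x1) ^ 2) by apply pow2_ge_0.
    rewrite (unit_pythagoras e1 e2 x1 x2 He). lra. }
  assert (((X + 4 / 5) / 2) ^ 2 <= (e1 * x1 + e2 * x2) ^ 2) by (apply pow_incr; lra).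
  nra. }
(* Multiplying [HD] by [e1] and subtracting [Hx] eliminates [x1]. The lower bounds on [x2] and [X]
   then force [e1] too close to its maximum. *)
assert (K1 : 2 * (e1 - e2) * x2 < e1 - 4 / 5 - (1 - e1) * X) by nra.
assert (K2 : (1 - e1) * (3 / 10) <= (1 - e1) * X) by nra.
assert (K3 : 2 * (e1 - e2) * (e2 - 448 / 1000) <= 2 * (e1 - e2) * x2) by nra.
assert (846 / 1000 < e1) by nra.
assert (e2 <= 534 / 1000) by nra.
nra.
Qed.

(** If [x] or [t] is outside the unit disc around 1, then [e] has slope at least 3/5. This puts [x]
    in the unit disc around 1 + i and [t] in the first quadrant, where its coordinates lie in [0, 1]
    and dominate their squares. *)
Lemma unit_reduction (e1 e2 x1 x2 t1 t2 : R) :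
  e1 ^ 2 + e2 ^ 2 = 1 -> 0 <= e2 -> e2 <= e1 ->
  x1 ^ 2 + x2 ^ 2 < 1 -> t1 ^ 2 + t2 ^ 2 < 1 ->
  x1 ^ 2 + x2 ^ 2 + 4 / 5 <= 2 * (e1 * x1 + e2 * x2) ->
  0 <= e1 * t1 + e2 * t2 ->
  4 / 5 * (t1 ^ 2 + t2 ^ 2) <= (e1 * t1 + e2 * t2) ^ 2 ->
  near 1 1 1 1 0 x1 x2 t1 t2 \/ near 1 1 1 0 1 x1 x2 t1 t2 \/
  near 1 2 1 1 1 x1 x2 t1 t2.
Proof.
intros He He2 He12 HX HT Hx Hdt Hct.
assert (Hdx : 0 <= e1 * x1 + e2 * x2) by nra.
(* By AM-GM: the disc of radius 1/sqrt 5 around [e] is seen from 0 within the angle arcsin (1/sqrt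
   5) = atan (1/2). *)
assert (Hcx : 4 / 5 * (x1 ^ 2 + x2 ^ 2) <= (e1 * x1 + e2 * x2) ^ 2).
{ assert (0 <= (x1 ^ 2 + x2 ^ 2 - 4 / 5) ^ 2) by apply pow2_ge_0.
  assert (((x1 ^ 2 + x2 ^ 2 + 4 / 5) / 2) ^ 2 <= (e1 * x1 + e2 * x2) ^ 2)
    by (apply pow_incr; nra).
  lra. }
assert (HE : 3 * e1 <= 5 * e2 -> t1 ^ 2 + t2 ^ 2 <= t1 + t2).
{ intro Hs.
  destruct (nonneg_coords_of_cone e1 e2 t1 t2) as [P1 P2]; try assumption.
  nra. }
unfold near.
destruct (Rle_or_lt (x1 ^ 2 + x2 ^ 2) (2 * x1)) as [Ax|Ax].
- destruct (Rle_or_lt (t1 ^ 2 + t2 ^ 2) (2 * t1)) as [At|At]; [left; lra|].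
  assert (Hs := off_axis_slope e1 e2 t1 t2 He He2 He12 HT Hdt Hct At).
  assert (HD := diagonal_of_slope e1 e2 x1 x2 He He2 He12 Hs Hx).
  specialize (HE Hs). right; right; lra.
- assert (Hs := off_axis_slope e1 e2 x1 x2 He He2 He12 HX Hdx Hcx Ax).
  assert (HD := diagonal_of_slope e1 e2 x1 x2 He He2 He12 Hs Hx).
  specialize (HE Hs). right; right; lra.
Qed.

(** With [s] = |g| |h|, the unit vector [(m / s, n / s)] points along g conj h. The centres g/h for
    [x] and conj (h/g) for [t] are on its ray, at distances at least 1 and at most 1 from 0. *)
Lemma near_reduction_large (k l m n x1 x2 t1 t2 : R) :
  5 <= l -> l <= k -> m * m + n * n = k * l -> 0 <= n -> n <= m ->
  x1 ^ 2 + x2 ^ 2 < 1 -> t1 ^ 2 + t2 ^ 2 < 1 -> near 1 k l m n x1 x2 t1 t2 ->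
  near 1 1 1 1 0 x1 x2 t1 t2 \/ near 1 1 1 0 1 x1 x2 t1 t2 \/
  near 1 2 1 1 1 x1 x2 t1 t2.
Proof.
intros Hl Hlk HA Hn Hnm HX HT [Hx Ht].
set (s := sqrt (k * l)).
assert (Hs2 : s * s = k * l) by (apply sqrt_sqrt; nra).
assert (Hsl : l <= s).
{ rewrite <- (sqrt_square l) by lra. apply sqrt_le_1_alt; nra. }
assert (Hs : 0 < s) by lra.
clearbody s.
assert (Ex : m * x1 + n * x2 = s * (m / s * x1 + n / s * x2)) by (field; lra).
assert (Et : m * t1 + n * t2 = s * (m / s * t1 + n / s * t2)) by (field; lra).
assert (He : (m / s) ^ 2 + (n / s) ^ 2 = 1).
{ transitivity ((m * m + n * n) / (s * s)); [field; lra|].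
  rewrite HA, Hs2; field; split; lra. }
assert (He2 : 0 <= n / s) by (apply Rdiv_le_0_compat; lra).
assert (He12 : n / s <= m / s).
{ apply Rmult_le_compat_r; [left; apply Rinv_0_lt_compat|]; lra. }
rewrite Ex in Hx; rewrite Et in Ht.
revert He He2 He12 Hx Ht; generalize (m / s) (n / s); intros e1 e2 He He2 He12 Hx Ht.
clear Ex Et.
apply (unit_reduction e1 e2); try assumption.
- clear Ht.
  remember (x1 ^ 2 + x2 ^ 2) as X eqn:EX.
  assert (HX0 : 0 <= X) by (subst X; nra).
  (* Expanded with [s * s = k * l], this gives [H2], which moves the centre g/h back to [e]: inside
     the unit disc, |x - e|^2 <= 1/l still holds. *)
  assert (H1 : 0 <= (s - l) * (s + 1 - l * X)) by (apply Rmult_le_pos; nra).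
  assert (H2 : s * (l * X + l - 1) <= l * (k - 1 + l * X)) by lra.
  assert (H3 : s * (l * (X + 4 / 5)) <= s * (l * X + l - 1))
    by (apply Rmult_le_compat_l; lra).
  apply Rmult_le_reg_l with (s * l); [nra|].
  apply Rle_trans with (l * (k - 1 + l * X)); [lra|].
  apply Rle_trans with (l * (2 * (s * (e1 * x1 + e2 * x2)))); [|lra].
  apply Rmult_le_compat_l; lra.
- apply Rmult_le_reg_l with s; nra.
- remember (t1 ^ 2 + t2 ^ 2) as T eqn:ET.
  assert (HT0 : 0 <= T) by (subst T; nra).
  assert (H1 : (l - 1 + k * T) ^ 2 <= (2 * (s * (e1 * t1 + e2 * t2))) ^ 2)
    by (apply pow_incr; nra).
  (* AM-GM bounds the square in [H1] below by [4 (l - 1) k T], and [l - 1 >= 4/5 l] because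
     [l >= 5]. *)
  assert (H2 : 0 <= (l - 1 - k * T) ^ 2) by apply pow2_ge_0.
  assert (H3 : 0 <= k * T * (l - 5)) by (apply Rmult_le_pos; nra).
  apply Rmult_le_reg_l with (s * s); [nra|].
  rewrite Hs2 at 1. nra.
Qed.

(** * Gaussian pairs with argument in [0, pi/4] *)

Lemma near_size_bound_Z (r k l m n : Z) (x1 x2 t1 t2 : R) :
  (0 < r <= k)%Z -> (0 < l <= k)%Z -> (m * m + n * n = k * l)%Z ->
  x1 ^ 2 + x2 ^ 2 < 1 -> near (IZR r) (IZR k) (IZR l) (IZR m) (IZR n) x1 x2 t1 t2 ->
  ((k + l - r) * (k + l - r) < 4 * (k * l))%Z.
Proof.
intros [Hr Hrk] [Hl Hlk] HA HX Hnear.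
apply lt_IZR. rewrite !mult_IZR, !minus_IZR, !plus_IZR.
apply IZR_lt in Hr, Hl. apply IZR_le in Hrk, Hlk.
assert (HB := near_size_bound (IZR r) (IZR k) (IZR l) (IZR m) (IZR n) x1 x2 t1 t2).
replace ((IZR k + IZR l - IZR r) * (IZR k + IZR l - IZR r))
  with ((IZR k + IZR l - IZR r) ^ 2) by ring.
apply HB; try assumption.
rewrite <- !mult_IZR, <- plus_IZR, HA; reflexivity.
Qed.

Lemma near_reduction_sector (k l m n : Z) (x1 x2 t1 t2 : R) :
  (0 < l <= k)%Z -> (m * m + n * n = k * l)%Z -> (0 <= n <= m)%Z ->
  x1 ^ 2 + x2 ^ 2 < 1 -> t1 ^ 2 + t2 ^ 2 < 1 ->
  near 1 (IZR k) (IZR l) (IZR m) (IZR n) x1 x2 t1 t2 ->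
  near 1 1 1 1 0 x1 x2 t1 t2 \/ near 1 1 1 0 1 x1 x2 t1 t2 \/
  near 1 2 1 1 1 x1 x2 t1 t2.
Proof.
intros Hlk HA Hnm HX HT Hnear.
destruct (Z_le_gt_dec 5 l) as [Hl5|Hl5].
- apply (near_reduction_large (IZR k) (IZR l) (IZR m) (IZR n)); try assumption.
  + apply IZR_le; lia.
  + apply IZR_le; lia.
  + rewrite <- !mult_IZR, <- plus_IZR, HA; reflexivity.
  + apply IZR_le; lia.
  + apply IZR_le; lia.
- assert (HB : ((k + l - 1) * (k + l - 1) < 4 * (k * l))%Z).
  { apply (near_size_bound_Z 1 k l m n x1 x2 t1 t2); try assumption; lia. }
  assert (Hl : (l = 1 \/ l = 2 \/ l = 3 \/ l = 4)%Z) by lia.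
  (* The extreme case is [l = 4], where [HB] reads (k - 1)(k - 9) < 0; hence also [m * m <= 32]. *)
  assert (Hk : (k <= 8)%Z) by (destruct Hl as [->|[->|[->| ->]]]; nia).
  assert (Hk' : (k = 1 \/ k = 2 \/ k = 3 \/ k = 4 \/ k = 5 \/ k = 6 \/ k = 7 \/ k = 8)%Z)
    by lia.
  assert (Hm : (m <= 5)%Z) by nia.
  assert (Hm' : (m = 0 \/ m = 1 \/ m = 2 \/ m = 3 \/ m = 4 \/ m = 5)%Z) by lia.
  assert (Hn' : (n = 0 \/ n = 1 \/ n = 2 \/ n = 3 \/ n = 4 \/ n = 5)%Z) by lia.
  clear Hk Hm Hl5.
  unfold near in *.
  (* Here [lia] removes the tuples that violate [HA], [HB] or the order constraints. *)
  repeat match goal with H : _ \/ _ |- _ => destruct H end; subst; try lia.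
  all: try (left; lra). all: try (right; right; lra). all: left; split; nra.
Qed.

(** * Symmetries and the reduction of all Gaussian pairs *)

Lemma near_swap (r k l m n x1 x2 t1 t2 : R) :
  near r k l m n x1 x2 t1 t2 -> near r l k m n t1 t2 x1 x2.
Proof. unfold near; tauto. Qed.

Lemma near_diag (r k l m n x1 x2 t1 t2 : R) :
  near r k l m n x1 x2 t1 t2 -> near r k l n m x2 x1 t2 t1.
Proof. unfold near; intros [H1 H2]; split; lra. Qed.

Lemma near_refl (r k l m n x1 x2 t1 t2 : R) :
  near r k l m n x1 x2 t1 t2 -> near r k l (- m) n (- x1) x2 (- t1) t2.
Proof. unfold near; intros [H1 H2]; split; lra. Qed.

(** The first move exchanges [u] and [v] and conjugates, which fixes [(m, n)]. The other two are the
    reflections in the diagonal and in the imaginary axis; they generate the symmetry group of the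
    square, with fundamental domain [0 <= n <= m]. *)
Lemma dihedral_wlog (P : Z -> Z -> Z -> Z -> R -> R -> R -> R -> Prop) :
  (forall k l m n x1 x2 t1 t2, P k l m n x1 x2 t1 t2 -> P l k m n t1 t2 x1 x2) ->
  (forall k l m n x1 x2 t1 t2, P k l m n x1 x2 t1 t2 -> P k l n m x2 x1 t2 t1) ->
  (forall k l m n x1 x2 t1 t2,
     P k l m n x1 x2 t1 t2 -> P k l (- m)%Z n (- x1) x2 (- t1) t2) ->
  (forall k l m n x1 x2 t1 t2, (l <= k)%Z -> (0 <= n <= m)%Z -> P k l m n x1 x2 t1 t2) ->
  forall k l m n x1 x2 t1 t2, P k l m n x1 x2 t1 t2.
Proof.
intros Hswap Hdiag Hrefl Hsec.
assert (Hm : forall k l m n x1 x2 t1 t2,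
  (l <= k)%Z -> (0 <= m)%Z -> (0 <= n)%Z -> P k l m n x1 x2 t1 t2).
{ intros k l m n x1 x2 t1 t2 Hk Hm Hn.
  destruct (Z_le_gt_dec n m); [|apply Hdiag]; apply Hsec; lia. }
assert (Hn : forall k l m n x1 x2 t1 t2,
  (l <= k)%Z -> (0 <= n)%Z -> P k l m n x1 x2 t1 t2).
{ intros k l m n x1 x2 t1 t2 Hk Hn.
  destruct (Z_le_gt_dec 0 m); [apply Hm; lia|].
  rewrite <- (Z.opp_involutive m), <- (Ropp_involutive x1), <- (Ropp_involutive t1).
  apply Hrefl, Hm; lia. }
assert (Hk : forall k l m n x1 x2 t1 t2, (l <= k)%Z -> P k l m n x1 x2 t1 t2).
{ intros k l m n x1 x2 t1 t2 Hk.
  destruct (Z_le_gt_dec 0 n); [apply Hn; lia|].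
  (* The sign of [n] is changed by conjugating the reflection of [m] with the diagonal one. *)
  apply Hdiag.
  rewrite <- (Z.opp_involutive n), <- (Ropp_involutive x2), <- (Ropp_involutive t2).
  apply Hrefl, Hdiag, Hn; lia. }
intros k l m n x1 x2 t1 t2.
destruct (Z_le_gt_dec l k); [|apply Hswap]; apply Hk; lia.
Qed.

(** The bound [k * l <= 2] is |g| |h| <= sqrt 2. Unlike a list of pairs in one sector, this form is
    stable under the symmetries. *)
Definition near_gauss_pair (k l m n : Z) (x1 x2 t1 t2 : R) : Prop :=
  (0 < k)%Z /\ (0 < l)%Z /\ (m * m + n * n = k * l)%Z /\ (k * l <= 2)%Z /\
  near 1 (IZR k) (IZR l) (IZR m) (IZR n) x1 x2 t1 t2.

Theorem gauss_near_reduction (k l m n : Z) (x1 x2 t1 t2 : R) :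
  (0 < k)%Z -> (0 < l)%Z -> (m * m + n * n = k * l)%Z ->
  x1 ^ 2 + x2 ^ 2 < 1 -> t1 ^ 2 + t2 ^ 2 < 1 ->
  near 1 (IZR k) (IZR l) (IZR m) (IZR n) x1 x2 t1 t2 ->
  exists k' l' m' n', near_gauss_pair k' l' m' n' x1 x2 t1 t2.
Proof.
revert k l m n x1 x2 t1 t2.
apply (dihedral_wlog (fun k l m n x1 x2 t1 t2 =>
  (0 < k)%Z -> (0 < l)%Z -> (m * m + n * n = k * l)%Z ->
  x1 ^ 2 + x2 ^ 2 < 1 -> t1 ^ 2 + t2 ^ 2 < 1 ->
  near 1 (IZR k) (IZR l) (IZR m) (IZR n) x1 x2 t1 t2 ->
  exists k' l' m' n', near_gauss_pair k' l' m' n' x1 x2 t1 t2)).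
- intros k l m n x1 x2 t1 t2 H Hk Hl HA HX HT Hn.
  destruct H as (k' & l' & m' & n' & Hk' & Hl' & HA' & Hle & Hn');
    try assumption; [lia | now apply near_swap |].
  exists l', k', m', n'.
  do 4 (split; [lia|]); now apply near_swap.
- intros k l m n x1 x2 t1 t2 H Hk Hl HA HX HT Hn.
  destruct H as (k' & l' & m' & n' & Hk' & Hl' & HA' & Hle & Hn');
    try assumption; [lia | lra | lra | now apply near_diag |].
  exists k', l', n', m'.
  do 4 (split; [lia|]); now apply near_diag.
- intros k l m n x1 x2 t1 t2 H Hk Hl HA HX HT Hn.
  destruct H as (k' & l' & m' & n' & Hk' & Hl' & HA' & Hle & Hn');
    try assumption; [lia | lra | lra | |].
  { apply near_refl in Hn.
    rewrite <- opp_IZR, Z.opp_involutive, !Ropp_involutive in Hn; exact Hn. }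
  exists k', l', (- m')%Z, n'.
  do 4 (split; [lia|]); rewrite opp_IZR; now apply near_refl.
- intros k l m n x1 x2 t1 t2 Hlk Hnm Hk Hl HA HX HT Hn.
  destruct (near_reduction_sector k l m n x1 x2 t1 t2) as [H|[H|H]];
    try assumption; try lia.
  + exists 1%Z, 1%Z, 1%Z, 0%Z; do 4 (split; [lia|]); exact H.
  + exists 1%Z, 1%Z, 0%Z, 1%Z; do 4 (split; [lia|]); exact H.
  + exists 2%Z, 1%Z, 1%Z, 1%Z; do 4 (split; [lia|]); exact H.
Qed.

(** * Reduction to the unit pairs of J^2 *)

(** The target asks for distance at most sqrt 2 to a common unit. Besides unit pairs, only m + n i
    with [m] and [n] equal to 1 or -1 occurs. The unit disc around it lies in the half-plane m Re >=
    0, and the disc around its half of radius 1/sqrt 2 lies in the disc of radius sqrt 2 around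
    [m]. *)
Lemma near_gauss_pair_unit (k l m n : Z) (x1 x2 t1 t2 : R) :
  x1 ^ 2 + x2 ^ 2 < 1 -> t1 ^ 2 + t2 ^ 2 < 1 ->
  near_gauss_pair k l m n x1 x2 t1 t2 ->
  exists m' n', (m' * m' + n' * n' = 1)%Z /\ near 2 1 1 (IZR m') (IZR n') x1 x2 t1 t2.
Proof.
intros HX HT (Hk & Hl & HA & Hle & Hx & Ht).
assert (Hkl : (k = 1 /\ l = 1 \/ k = 1 /\ l = 2 \/ k = 2 /\ l = 1)%Z) by nia.
destruct Hkl as [[-> ->]|Hkl].
- exists m, n; split; [lia|]; unfold near; split; lra.
- assert (HA2 : (m * m + n * n = 2)%Z) by (destruct Hkl as [[-> ->]|[-> ->]]; lia).
  clear HA Hle.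
  assert (Hn1 : (-1 <= n <= 1)%Z) by nia.
  assert (Hm1 : (-1 <= m <= 1)%Z) by nia.
  assert (Hn0 : n <> 0%Z) by (intros ->; nia).
  assert (Hm0 : m <> 0%Z) by (intros ->; nia).
  assert (Hn2 : (n = 1 \/ n = -1)%Z) by lia.
  assert (Hm2 : (m = 1 \/ m = -1)%Z) by lia.
  exists m, 0%Z; split; [lia|].
  assert (0 <= x1 ^ 2) by apply pow2_ge_0.
  assert (0 <= t1 ^ 2) by apply pow2_ge_0.
  assert (0 <= (x2 - 1) ^ 2) by apply pow2_ge_0.
  assert (0 <= (x2 + 1) ^ 2) by apply pow2_ge_0.
  assert (0 <= (t2 - 1) ^ 2) by apply pow2_ge_0.
  assert (0 <= (t2 + 1) ^ 2) by apply pow2_ge_0.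
  unfold near.
  destruct Hkl as [[-> ->]|[-> ->]]; destruct Hn2 as [-> | ->];
    destruct Hm2 as [-> | ->]; split; lra.
Qed.

(** The point [x] is within 45 degrees of [(m, n)], whose argument is in [0, pi/4]. *)
Lemma nonneg_of_quarter_cone (m n x1 x2 : R) :
  0 < m -> 0 <= n -> n <= m -> 0 <= m * x1 + n * x2 ->
  (m * m + n * n) * (x1 ^ 2 + x2 ^ 2) <= 2 * (m * x1 + n * x2) ^ 2 -> 0 <= x1.
Proof.
intros Hm Hn Hnm Hd Hc.
assert (Habs : Rabs (m * x2 - n * x1) <= Rabs (m * x1 + n * x2)).
{ apply Rsqr_le_abs_0; unfold Rsqr; lra. }
rewrite (Rabs_pos_eq _ Hd) in Habs.
apply Rabs_le_between in Habs; destruct Habs as [H1 H2].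
apply Rmult_le_reg_l with (m * m + n * n); [nra|].
replace ((m * m + n * n) * x1)
  with (m * (m * x1 + n * x2) - n * (m * x2 - n * x1)) by ring.
nra.
Qed.

Lemma near_half_sector (k l m n : Z) (x1 x2 t1 t2 : R) :
  (0 < l <= k)%Z -> Z.Odd l -> Z.Odd k -> (m * m + n * n = k * l)%Z -> (0 <= n <= m)%Z ->
  x1 ^ 2 + x2 ^ 2 < 1 -> t1 ^ 2 + t2 ^ 2 < 1 ->
  near 2 (IZR k) (IZR l) (IZR m) (IZR n) x1 x2 t1 t2 ->
  near 2 1 1 1 0 x1 x2 t1 t2.
Proof.
intros Hlk Hlodd Hkodd HA Hnm HX HT Hnear.
destruct (Z_le_gt_dec 4 l) as [Hl4|Hl4].
- assert (HAR : IZR m * IZR m + IZR n * IZR n = IZR k * IZR l)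
    by (rewrite <- !mult_IZR, <- plus_IZR, HA; reflexivity).
  assert (Hm0 : (0 < m)%Z) by nia.
  destruct Hnear as [Hx Ht].
  assert (Hl4' := IZR_le _ _ Hl4).
  destruct Hlk as [_ Hlk]; apply IZR_le in Hlk.
  destruct Hnm as [Hn Hnm]; apply IZR_le in Hn, Hnm; apply IZR_lt in Hm0.
  clear HA Hlodd Hkodd Hl4.
  revert HAR Hm0 Hx Ht Hl4' Hlk Hn Hnm.
  generalize (IZR k) (IZR l) (IZR m) (IZR n); clear k l m n; intros k l m n.
  intros HA Hm Hx Ht Hl Hlk Hn Hnm.
  (* AM-GM gives [(k - 2) l Y <= (m y1 + n y2)^2], and [2 (k - 2) >= k] exactly when [k >= 4]. The
     claim is stated for general [k] and [l] to serve [x] and, with them exchanged, [t]. *)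
  assert (cone : forall k l y1 y2, 4 <= k -> 0 < l -> m * m + n * n = k * l ->
    k - 2 + l * (y1 ^ 2 + y2 ^ 2) <= 2 * (m * y1 + n * y2) -> 0 <= y1).
  { clear - Hm Hn Hnm; intros k l y1 y2 Hk Hl HA Hy.
    assert (HY : 0 <= y1 ^ 2 + y2 ^ 2) by nra.
    apply (nonneg_of_quarter_cone m n y1 y2); try assumption; [nra|].
    rewrite HA.
    remember (y1 ^ 2 + y2 ^ 2) as Y eqn:EY.
    assert (H1 : (k - 2 + l * Y) ^ 2 <= (2 * (m * y1 + n * y2)) ^ 2)
      by (apply pow_incr; nra).
    assert (H2 : 0 <= (k - 2 - l * Y) ^ 2) by apply pow2_ge_0.
    assert (H3 : 0 <= l * Y * (k - 4)) by (apply Rmult_le_pos; nra).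
    lra. }
  assert (0 <= x1) by (apply (cone k l x1 x2); lra).
  assert (0 <= t1) by (apply (cone l k t1 t2); lra).
  unfold near; split; lra.
- destruct Hlodd as [l' El], Hkodd as [k' Ek].
  assert (Hl : (l = 1 \/ l = 3)%Z) by lia.
  (* The size bound requires [r <= k], so [k = 1] is set apart. *)
  assert (HB : (k = 1 \/ (k + l - 2) * (k + l - 2) < 4 * (k * l))%Z).
  { destruct (Z_le_gt_dec 2 k) as [H2k|]; [right|lia].
    apply (near_size_bound_Z 2 k l m n x1 x2 t1 t2); try assumption; lia. }
  assert (Hk : (k <= 9)%Z) by (destruct Hl as [-> | ->]; clear - HB; nia).
  assert (Hk' : (k = 1 \/ k = 3 \/ k = 5 \/ k = 7 \/ k = 9)%Z) by lia.
  assert (Hm : (m * m <= 27)%Z).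
  { destruct Hl as [-> | ->]; destruct Hk' as [->|[->|[->|[->| ->]]]];
      clear - HA; nia. }
  assert (Hm5 : (m <= 5)%Z) by (clear - Hm; nia).
  assert (Hm' : (m = 0 \/ m = 1 \/ m = 2 \/ m = 3 \/ m = 4 \/ m = 5)%Z) by lia.
  assert (Hn' : (n = 0 \/ n = 1 \/ n = 2 \/ n = 3 \/ n = 4 \/ n = 5)%Z) by lia.
  clear Hk Hm Hm5 El Ek.
  unfold near in *.
  repeat match goal with H : _ \/ _ |- _ => destruct H end; subst; try lia.
  all: try (split; lra). all: split; nra.
Qed.

Theorem half_near_reduction (k l m n : Z) (x1 x2 t1 t2 : R) :
  (0 < k)%Z -> (0 < l)%Z -> Z.Odd k -> Z.Odd l -> (m * m + n * n = k * l)%Z ->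
  x1 ^ 2 + x2 ^ 2 < 1 -> t1 ^ 2 + t2 ^ 2 < 1 ->
  near 2 (IZR k) (IZR l) (IZR m) (IZR n) x1 x2 t1 t2 ->
  exists m' n', (m' * m' + n' * n' = 1)%Z /\ near 2 1 1 (IZR m') (IZR n') x1 x2 t1 t2.
Proof.
revert k l m n x1 x2 t1 t2.
apply (dihedral_wlog (fun k l m n x1 x2 t1 t2 =>
  (0 < k)%Z -> (0 < l)%Z -> Z.Odd k -> Z.Odd l -> (m * m + n * n = k * l)%Z ->
  x1 ^ 2 + x2 ^ 2 < 1 -> t1 ^ 2 + t2 ^ 2 < 1 ->
  near 2 (IZR k) (IZR l) (IZR m) (IZR n) x1 x2 t1 t2 ->
  exists m' n', (m' * m' + n' * n' = 1)%Z /\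
    near 2 1 1 (IZR m') (IZR n') x1 x2 t1 t2)).
- intros k l m n x1 x2 t1 t2 H Hk Hl Ok Ol HA HX HT Hn.
  destruct H as (m' & n' & HA' & Hn');
    try assumption; [lia | now apply near_swap |].
  exists m', n'; split; [lia|]; now apply near_swap.
- intros k l m n x1 x2 t1 t2 H Hk Hl Ok Ol HA HX HT Hn.
  destruct H as (m' & n' & HA' & Hn');
    try assumption; [lia | lra | lra | now apply near_diag |].
  exists n', m'; split; [lia|]; now apply near_diag.
- intros k l m n x1 x2 t1 t2 H Hk Hl Ok Ol HA HX HT Hn.
  destruct H as (m' & n' & HA' & Hn');
    try assumption; [lia | lra | lra | |].
  { apply near_refl in Hn.
    rewrite <- opp_IZR, Z.opp_involutive, !Ropp_involutive in Hn; exact Hn. }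
  exists (- m')%Z, n'; split; [lia|]; rewrite opp_IZR; now apply near_refl.
- intros k l m n x1 x2 t1 t2 Hlk Hnm Hk Hl Ok Ol HA HX HT Hn.
  exists 1%Z, 0%Z; split; [lia|].
  now apply (near_half_sector k l m n).
Qed.

(** * Translation of the norm condition into real inequalities *)

Lemma Cmod_sqr (z : C) : (Cmod z ^ 2 = fst z ^ 2 + snd z ^ 2)%R.
Proof. unfold Cmod; apply pow2_sqrt; nra. Qed.

Lemma Cmod_le_1 (z : C) : Cmod z <= 1 <-> (fst z ^ 2 + snd z ^ 2 <= 1)%R.
Proof.
rewrite <- Cmod_sqr. assert (H0 := Cmod_ge_0 z). split; intro H; nra.
Qed.

Lemma Cmod_lt_1 (z : C) : Cmod z < 1 -> (fst z ^ 2 + snd z ^ 2 < 1)%R.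
Proof.
intro H; rewrite <- Cmod_sqr. assert (H0 := Cmod_ge_0 z); nra.
Qed.

(** As |w1|, |w2| < 1, the two weights are |u1| and |v2|, and they cancel. *)
Lemma uvnorm_lincomb (u1 v2 w1 w2 g h : C) :
  0 < Cmod u1 -> 0 < Cmod v2 -> Cmod w1 < 1 -> Cmod w2 < 1 ->
  uvnorm (u1, v2 * w2)%C (u1 * w1, v2)%C
    (lincomb g h (u1, v2 * w2)%C (u1 * w1, v2)%C) =
  Rmax (Cmod (g + h * w1)%C) (Cmod (h + g * w2)%C).
Proof.
intros Hu Hv Hw1 Hw2. unfold uvnorm.
change (lincomb g h (u1, v2 * w2)%C (u1 * w1, v2)%C)
  with ((g * u1 + h * (u1 * w1))%C, (g * (v2 * w2) + h * v2)%C).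
cbn [fst snd].
rewrite (Rmax_left (Cmod u1)) by (rewrite Cmod_mult; nra).
rewrite (Rmax_right (Cmod (v2 * w2)%C)) by (rewrite Cmod_mult; nra).
replace (g * u1 + h * (u1 * w1))%C with ((g + h * w1) * u1)%C by ring.
replace (g * (v2 * w2) + h * v2)%C with ((h + g * w2) * v2)%C by ring.
rewrite !Cmod_mult.
f_equal; field; lra.
Qed.

(** The common factor [q] covers both lattices: 1 with [r = 1] for Z[i]^2, and 1/(1+i) with [r = 2]
    for J^2. *)
Lemma uvnorm_le_1_near (q u1 v2 w1 w2 : C) (r a b c d : R) :
  (Cmod q ^ 2 * r = 1)%R ->
  0 < Cmod u1 -> 0 < Cmod v2 -> Cmod w1 < 1 -> Cmod w2 < 1 ->
  uvnorm (u1, v2 * w2)%C (u1 * w1, v2)%C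
    (lincomb (q * (a, b))%C (q * (c, d))%C (u1, v2 * w2)%C (u1 * w1, v2)%C) <= 1 <->
  near r (a * a + b * b) (c * c + d * d) (a * c + b * d) (b * c - a * d)
    (- fst w1) (- snd w1) (- fst w2) (snd w2).
Proof.
intros Hq Hu Hv Hw1 Hw2.
rewrite uvnorm_lincomb by assumption.
assert (Hr : 0 < r).
{ assert (H0 : 0 <= Cmod q ^ 2) by apply pow2_ge_0. nra. }
assert (Hscale : forall z : C,
  Cmod (q * z)%C <= 1 <-> (fst z ^ 2 + snd z ^ 2 <= r)%R).
{ intro z. rewrite <- Cmod_sqr, Cmod_mult.
  assert (H0 := Cmod_ge_0 z). assert (H1 := Cmod_ge_0 q).
  assert (E : ((Cmod q * Cmod z) ^ 2 * r = Cmod z ^ 2)%R)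
    by (transitivity (Cmod q ^ 2 * r * Cmod z ^ 2)%R; [ring | rewrite Hq; ring]).
  assert (H2 : 0 <= Cmod q * Cmod z) by (apply Rmult_le_pos; assumption).
  split; intro H.
  - assert ((Cmod q * Cmod z) ^ 2 <= 1) by nra. rewrite <- E. nra.
  - apply Rnot_lt_le; intro H3.
    assert (1 < (Cmod q * Cmod z) ^ 2) by nra. nra. }
replace (q * (a, b) + q * (c, d) * w1)%C with (q * ((a, b) + (c, d) * w1))%C by ring.
replace (q * (c, d) + q * (a, b) * w2)%C with (q * ((c, d) + (a, b) * w2))%C by ring.
assert (Hmax : forall y z : R, Rmax y z <= 1 <-> y <= 1 /\ z <= 1).
{ intros y z; split; [|intros []; now apply Rmax_lub].
  intro H; split; eapply Rle_trans; try exact H; [apply Rmax_l | apply Rmax_r]. }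
rewrite Hmax, !Hscale.
destruct w1 as [p1 p2], w2 as [s1 s2].
unfold near; cbn [fst snd Cplus Cmult].
split; intros [H1 H2]; split; lra.
Qed.

Lemma norm_prod (a b c d : Z) :
  ((a * c + b * d) * (a * c + b * d) + (b * c - a * d) * (b * c - a * d) =
   (a * a + b * b) * (c * c + d * d))%Z.
Proof. ring. Qed.

(** * Gaussian integers and lattice vectors *)

Lemma gaussInt_norm_le_1_U4 (a b : Z) :
  (IZR a, IZR b) <> RtoC 0 -> Cmod (IZR a, IZR b) <= 1 -> U4 (IZR a, IZR b).
Proof.
intros Hnz H. apply Cmod_le_1 in H; cbn [fst snd] in H.
assert (HZ : (a * a + b * b <= 1)%Z).
{ apply le_IZR. rewrite plus_IZR, !mult_IZR. lra. }
assert (Ha : (a = -1 \/ a = 0 \/ a = 1)%Z) by nia.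
assert (Hb : (b = -1 \/ b = 0 \/ b = 1)%Z) by nia.
unfold U4, Ci, Copp, RtoC; cbn [fst snd].
destruct Ha as [->|[->| ->]]; destruct Hb as [->|[->| ->]]; try lia.
- right; left; f_equal; lra.
- right; right; right; f_equal; lra.
- exfalso; now apply Hnz.
- right; right; left; reflexivity.
- left; reflexivity.
Qed.

Lemma gauss_nonzero_norm (a b : Z) :
  (IZR a, IZR b) <> RtoC 0 -> (0 < a * a + b * b)%Z.
Proof.
intro H. destruct (Z.eq_dec a 0) as [->|]; [|nia].
destruct (Z.eq_dec b 0) as [->|]; [exfalso; now apply H|nia].
Qed.

(** A Gaussian integer a + b i is divisible by 1 + i when a + b is even, and a + b has the parity of
    the norm. *)
Lemma J_odd_gauss (z : C) :
  J z -> exists a b, z = (/ (1 + Ci) * (IZR a, IZR b))%C /\ Z.Odd (a * a + b * b).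
Proof.
intros [(g & (a & b & ->) & ->) Hn].
exists a, b; split; [reflexivity|].
destruct (Z.Even_or_Odd (a + b)) as [[j Hj]|[j Hj]].
- exfalso; apply Hn. exists j, (b - j)%Z.
  replace (IZR a, IZR b) with ((1 + Ci) * (IZR j, IZR (b - j)))%C.
  + rewrite Cmult_assoc, Cinv_l, Cmult_1_l; [reflexivity|].
    intro E; apply (f_equal fst) in E; cbn in E; lra.
  + replace a with (2 * j - b)%Z by lia.
    unfold Cmult, Cplus, Ci, RtoC; cbn [fst snd].
    rewrite !minus_IZR, mult_IZR; f_equal; ring.
- exists (2 * j * j + 2 * j - a * b)%Z.
  replace b with (2 * j + 1 - a)%Z by lia. ring.
Qed.

Lemma Cmod_inv_1_plus_i : (Cmod (/ (1 + Ci))%C ^ 2 * 2 = 1)%R.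
Proof.
rewrite Cmod_inv, pow_inv, Cmod_sqr;
  [|intro E; apply (f_equal fst) in E; cbn in E; lra].
unfold Cplus, Ci, RtoC; cbn [fst snd]; field.
Qed.

Lemma gauss_zero_coords (a b : Z) :
  (IZR a, IZR b) = RtoC 0 -> a = 0%Z /\ b = 0%Z.
Proof.
intro E; split; apply eq_IZR; [exact (f_equal fst E) | exact (f_equal snd E)].
Qed.

(** If one coefficient vanishes, the norm bound makes the other a unit or zero, which is excluded;
    so [k] and [l] are positive. *)
Lemma gauss_short_near_pair (u v : C2) (u1 v2 w1 w2 : C) (z : C2) :
  u = (u1, v2 * w2)%C -> v = (u1 * w1, v2)%C ->
  0 < Cmod u1 -> 0 < Cmod v2 -> Cmod w1 < 1 -> Cmod w2 < 1 ->
  gaussSpan u v z -> z <> (RtoC 0, RtoC 0) -> ~ U4orbit u z -> ~ U4orbit v z ->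
  uvnorm u v z <= 1 ->
  exists k l m n, (0 < k)%Z /\ (0 < l)%Z /\ (m * m + n * n = k * l)%Z /\
    near 1 (IZR k) (IZR l) (IZR m) (IZR n) (- fst w1) (- snd w1) (- fst w2) (snd w2).
Proof.
intros hu hv hu1 hv2 hw1 hw2 (g & h & [a [b ->]] & [c [d ->]] & ->) Hz0 Hnu Hnv Hle.
assert (Hle' := Hle). rewrite hu, hv in Hle'.
rewrite uvnorm_lincomb in Hle' by assumption.
assert (H1 := Rle_trans _ _ _ (Rmax_l _ _) Hle').
assert (H2 := Rle_trans _ _ _ (Rmax_r _ _) Hle'). clear Hle'.
destruct (Ceq_dec (IZR a, IZR b) (RtoC 0)) as [Eg|Hg].
{ exfalso. rewrite Eg in *. apply Hnv. exists (IZR c, IZR d).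
  assert (El : lincomb (RtoC 0) (IZR c, IZR d) u v = scal ((IZR c, IZR d) : C) v).
  { unfold lincomb. replace (scal (RtoC 0) u) with (zero : C2); [apply plus_zero_l|].
    symmetry; exact (scal_zero_l (K := C_Ring) u). }
  split; [|exact El].
  apply gaussInt_norm_le_1_U4.
  - intro Eh; apply Hz0. rewrite El, Eh. exact (scal_zero_l (K := C_Ring) v).
  - replace (IZR c, IZR d) with ((IZR c, IZR d) + RtoC 0 * w2)%C by ring. exact H2. }
destruct (Ceq_dec (IZR c, IZR d) (RtoC 0)) as [Eh|Hh].
{ exfalso. rewrite Eh in *. apply Hnu. exists (IZR a, IZR b).
  assert (El : lincomb (IZR a, IZR b) (RtoC 0) u v = scal ((IZR a, IZR b) : C) u).
  { unfold lincomb. replace (scal (RtoC 0) v) with (zero : C2); [apply plus_zero_r|].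
    symmetry; exact (scal_zero_l (K := C_Ring) v). }
  split; [|exact El].
  apply gaussInt_norm_le_1_U4; [exact Hg|].
  replace (IZR a, IZR b) with ((IZR a, IZR b) + RtoC 0 * w1)%C by ring. exact H1. }
exists (a * a + b * b)%Z, (c * c + d * d)%Z, (a * c + b * d)%Z, (b * c - a * d)%Z.
split; [now apply gauss_nonzero_norm|]. split; [now apply gauss_nonzero_norm|].
split; [apply norm_prod|].
rewrite minus_IZR, !plus_IZR, !mult_IZR.
apply (uvnorm_le_1_near (RtoC 1) u1 v2 w1 w2 1); try assumption.
- rewrite Cmod_1; ring.
- rewrite !Cmult_1_l, <- hu, <- hv. exact Hle.
Qed.

(** [(m, n)] is [g * conj h] for [(g, h) = (m + n i, 1)] when [l = 1],
    and for [(1, m - n i)] when [k = 1]. *)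
Lemma near_gauss_pair_realize (u1 v2 w1 w2 : C) (k l m n : Z) :
  0 < Cmod u1 -> 0 < Cmod v2 -> Cmod w1 < 1 -> Cmod w2 < 1 ->
  near_gauss_pair k l m n (- fst w1) (- snd w1) (- fst w2) (snd w2) ->
  exists g h, gaussInt g /\ gaussInt h /\ g <> RtoC 0 /\ h <> RtoC 0 /\
    Cmod g * Cmod h <= sqrt 2 /\
    uvnorm (u1, v2 * w2)%C (u1 * w1, v2)%C
      (lincomb g h (u1, v2 * w2)%C (u1 * w1, v2)%C) <= 1.
Proof.
intros hu1 hv2 hw1 hw2 (Hk & Hl & HA & Hkl & Hn).
assert (H : exists a b c d, (a * a + b * b = k /\ c * c + d * d = l /\
  a * c + b * d = m /\ b * c - a * d = n)%Z).
{ assert (k = 1 \/ l = 1)%Z as [-> | ->] by nia.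
  - exists 1%Z, 0%Z, m, (- n)%Z; repeat split; lia.
  - exists m, n, 1%Z, 0%Z; repeat split; lia. }
destruct H as (a & b & c & d & <- & <- & <- & <-).
exists (IZR a, IZR b), (IZR c, IZR d).
split; [now exists a, b|]. split; [now exists c, d|].
split; [intro E; apply gauss_zero_coords in E as [-> ->]; lia|].
split; [intro E; apply gauss_zero_coords in E as [-> ->]; lia|].
split.
- rewrite <- Cmod_mult. unfold Cmod. apply sqrt_le_1_alt.
  apply IZR_le in Hkl. rewrite mult_IZR, !plus_IZR, !mult_IZR in Hkl.
  cbn [fst snd Cmult]. lra.
- rewrite <- (Cmult_1_l (IZR a, IZR b)), <- (Cmult_1_l (IZR c, IZR d)).
  apply (uvnorm_le_1_near (RtoC 1) u1 v2 w1 w2 1); try assumption.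
  + rewrite Cmod_1; ring.
  + rewrite <- !mult_IZR, <- !plus_IZR, <- minus_IZR. exact Hn.
Qed.

Local Open Scope C_scope.

Theorem mainTheorem3 (u v : C2) (u1 v2 w1 w2 : C)
  (hu : u = (u1, v2 * w2)) (hv : v = (u1 * w1, v2))
  (hu1 : (0 < Cmod u1)%R) (hv2 : (0 < Cmod v2)%R)
  (hw1 : (Cmod w1 < 1)%R) (hw2 : (Cmod w2 < 1)%R) :
  ((forall g h : C, gaussInt g -> gaussInt h -> g <> 0 -> h <> 0 ->
      (Cmod g * Cmod h <= sqrt 2)%R -> (1 < uvnorm u v (lincomb g h u v))%R) ->
   forall z : C2, gaussSpan u v z -> z <> (RtoC 0, RtoC 0) ->
     ~ U4orbit u z -> ~ U4orbit v z -> (1 < uvnorm u v z)%R)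
  /\
  ((forall a : C, U4 a ->
      (1 < uvnorm u v (lincomb (1 / (1 + Ci)) (a / (1 + Ci)) u v))%R) ->
   forall z : C2, jSpan u v z -> z <> (RtoC 0, RtoC 0) ->
     ~ U4orbit u z -> ~ U4orbit v z -> (1 < uvnorm u v z)%R).
Proof.
assert (hX : ((- fst w1) ^ 2 + (- snd w1) ^ 2 < 1)%R)
  by (assert (H := Cmod_lt_1 w1 hw1); lra).
assert (hT : ((- fst w2) ^ 2 + snd w2 ^ 2 < 1)%R)
  by (assert (H := Cmod_lt_1 w2 hw2); lra).
split.
- intros Hshort z Hz Hz0 Hnu Hnv.
  apply Rnot_le_lt; intro Hle.
  destruct (gauss_short_near_pair u v u1 v2 w1 w2 z hu hv hu1 hv2 hw1 hw2 Hz Hz0 Hnu Hnv Hle)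
    as (k & l & m & n & Hk & Hl & HA & Hn).
  destruct (gauss_near_reduction k l m n _ _ _ _ Hk Hl HA hX hT Hn)
    as (k' & l' & m' & n' & Hp).
  destruct (near_gauss_pair_realize u1 v2 w1 w2 k' l' m' n' hu1 hv2 hw1 hw2 Hp)
    as (g & h & Hg & Hh & Hg0 & Hh0 & Hgh & Hle').
  specialize (Hshort g h Hg Hh Hg0 Hh0 Hgh).
  rewrite <- hu, <- hv in Hle'. lra.
- intros Hunit z Hz Hz0 Hnu Hnv.
  apply Rnot_le_lt; intro Hle.
  assert (Hred : exists m n, (m * m + n * n = 1)%Z /\
    near 2 1 1 (IZR m) (IZR n) (- fst w1) (- snd w1) (- fst w2) (snd w2)).
  { destruct Hz as (g & h & [[Hg Hh]|[Hg Hh]] & Ez).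
    (* Coefficients in Z[i] first reduce to a short Gaussian pair, which then relaxes to a unit pair
       of J^2. *)
    - assert (Hz : gaussSpan u v z) by now exists g, h.
      destruct (gauss_short_near_pair u v u1 v2 w1 w2 z hu hv hu1 hv2 hw1 hw2
        Hz Hz0 Hnu Hnv Hle) as (k & l & m & n & Hk & Hl & HA & Hn).
      destruct (gauss_near_reduction k l m n _ _ _ _ Hk Hl HA hX hT Hn)
        as (k' & l' & m' & n' & Hp).
      exact (near_gauss_pair_unit k' l' m' n' _ _ _ _ hX hT Hp).
    - destruct (J_odd_gauss g Hg) as (a & b & -> & Hab).
      destruct (J_odd_gauss h Hh) as (c & d & -> & Hcd).
      subst z u v.
      apply (uvnorm_le_1_near _ u1 v2 w1 w2 2) in Hle;
        try assumption; [|exact Cmod_inv_1_plus_i].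
      rewrite <- !mult_IZR, <- !plus_IZR, <- minus_IZR in Hle.
      apply half_near_reduction in Hle; try assumption.
      + destruct Hab; nia.
      + destruct Hcd; nia.
      + apply norm_prod. }
  destruct Hred as (m & n & Hmn & Hn).
  (* Up to the factor 1/(1+i), the pair is (1, m - n i), for which g conj h is m + n i. *)
  specialize (Hunit (IZR m, IZR (- n))).
  assert (HU : U4 (IZR m, IZR (- n))).
  { apply gaussInt_norm_le_1_U4.
    - intro E. apply gauss_zero_coords in E. nia.
    - apply Cmod_le_1; cbn [fst snd].
      rewrite opp_IZR. replace (IZR m ^ 2 + (- IZR n) ^ 2)%R with (IZR (m * m + n * n)).
      + rewrite Hmn; apply Rle_refl.
      + rewrite plus_IZR, !mult_IZR; ring. }
  specialize (Hunit HU).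
  replace (1 / (1 + Ci)) with (/ (1 + Ci) * (1%R, 0%R)) in Hunit
    by (change (1%R, 0%R) with (RtoC 1); unfold Cdiv; ring).
  replace ((IZR m, IZR (- n)) / (1 + Ci)) with (/ (1 + Ci) * (IZR m, IZR (- n))) in Hunit
    by (unfold Cdiv; ring).
  apply Rlt_not_le in Hunit; apply Hunit. subst u v.
  apply (uvnorm_le_1_near _ u1 v2 w1 w2 2);
    try assumption; [exact Cmod_inv_1_plus_i|].
  assert (HmnR : (IZR m * IZR m + IZR n * IZR n = 1)%R)
    by (rewrite <- !mult_IZR, <- plus_IZR, Hmn; reflexivity).
  rewrite opp_IZR. unfold near in *. destruct Hn as [H1 H2].
  replace (IZR m * IZR m + - IZR n * - IZR n)%R with 1%R by lra.
  split; lra.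
Qed.
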